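(* Let $C$ be a real symmetric conference matrix of order $N$ and let $D_N=I+\mathbf{i}C$. Then $D_N$ admits an affine orbit, i.e. there exists an affine family of complex Hadamard matrices with at least one parameter which contains $D_N$.
   Context: A conference matrix of order $N$ is an $N\times N$ matrix $C$ with $C_{ii}=0$ for all $i$, $C_{ij}\in\{-1,1\}$ for $i\neq j$, and $CC^T=C^TC=(N-1)I$. If $C$ is real symmetric, $I+\mathbf{i}C$ is a complex Hadamard matrix, i.e. all entries have modulus $1$ and $HH^\ast=NI$. A complex Hadamard matrix is dephased if all entries of its first row and first column equal $1$. A parametric family of complex Hadamard matrices is affine if the phases (arguments) of its entries are each the sum of a constant and a linear function of the parameters. A matrix admits an affine orbit if there is a non-constant affine family (with at least one genuine parameter) containing a dephased form of it and consisting entirely of dephased complex Hadamard matrices (so that its members are not merely obtained from one another by multiplication with diagonal unitary matrices).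
   Formalization: The order N is assumed greater than 2: for N = 1 and N = 2 symmetric conference matrices exist, but there is only one dephased complex Hadamard matrix of that order, so no non-constant dephased affine family exists and the claim fails. *)

(* Defs.v *)
From HB Require Import structures.
From mathcomp Require Import all_boot all_order all_algebra.
From mathcomp Require Import complex.
From mathcomp Require Import reals trigo.

Set Implicit Arguments.
Unset Strict Implicit.
Unset Printing Implicit Defensive.

Import Order.TTheory GRing.Theory Num.Theory.

Local Open Scope ring_scope.
Local Open Scope complex_scope.
Local Open Scope sesquilinear_scope.

Definition conference_matrix (R : realType) (N : nat) (C : 'M[R]_N) : Prop :=
  [/\ forall i, C i i = 0,
      forall i j, i != j -> C i j = -1 \/ C i j = 1,
      C *m C^T = (N%:R - 1)%:M
    & C^T *m C = (N%:R - 1)%:M].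

Definition complex_hadamard (R : realType) (N : nat) (H : 'M[R[i]]_N) : Prop :=
  (forall i j, `|H i j| = 1) /\ H *m H^t* = N%:R%:M.

(* The first row and column are those of index 0 in 'I_N. *)
Definition dephased (R : realType) (N : nat) (H : 'M[R[i]]_N) : Prop :=
  forall i j : 'I_N, i = 0%N :> nat \/ j = 0%N :> nat -> H i j = 1.

(* K arises from H by multiplying rows and columns by unimodular scalars. *)
Definition dephased_form_of (R : realType) (N : nat) (H K : 'M[R[i]]_N) : Prop :=
  dephased K /\
  exists d e : 'rV[R[i]]_N,
    [/\ forall i, `|d 0 i| = 1,
        forall i, `|e 0 i| = 1
      & K = diag_mx d *m H *m diag_mx e].

Definition phase (R : realType) (x : R) : R[i] := cos x +i* sin x.

(* A family with parameter space R^m, presented by its member function F. *)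
Definition affine_family (R : realType) (N m : nat)
    (F : 'rV[R]_m -> 'M[R[i]]_N) : Prop :=
  exists (a : 'M[R]_N) (L : 'I_N -> 'I_N -> {linear 'rV[R]_m -> R^o}),
    forall t i j, F t i j = phase (a i j + L i j t).

Definition admits_affine_orbit (R : realType) (N : nat) (H : 'M[R[i]]_N) : Prop :=
  exists (m : nat) (F : 'rV[R]_m -> 'M[R[i]]_N),
    [/\ (0 < m)%N /\ affine_family F,
        forall t, complex_hadamard (F t),
        forall t, dephased (F t),
        exists s t, F s <> F t
      & exists t, dephased_form_of H (F t)].

Definition conference_hadamard (R : realType) (N : nat) (C : 'M[R]_N) :
    'M[R[i]]_N :=
  1%:M + 'i *: map_mx (real_complex R) C.

(* Main.v *)
(* Let D = I + iC.  Take two rows x, y of C other than the base row o, put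
   eps = C x o * C y o, and let S be the set of the columns j with
   C x j * C y j = - eps.  With f = e_x - eps e_y one has f D = l f + w with w
   supported on S, because the pair (C x j, C y j) is a multiple of (1, - eps)
   for j in S, and orthogonal to it for the other j outside {x, y}.
   Conjugating D by the unitary matrix that multiplies f by u, |u| = 1, and
   fixes its orthogonal complement therefore only multiplies the entries of D
   in rows x, y and columns S by u, and those in rows S and columns x, y by the
   conjugate of u.  So u = exp(i t) gives an affine family of Hadamard matrices
   through D.  Since o is not in S, row and column o do not move and one
   constant dephasing works for all t; S is nonempty because rows x and y are
   orthogonal. *)

Require Import Defs.
From HB Require Import structures.
From mathcomp Require Import all_boot all_order all_algebra.
From mathcomp Require Import complex reals trigo.
From mathcomp Require Import ring lra.

Set Implicit Arguments.
Unset Strict Implicit.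
Unset Printing Implicit Defensive.

Import Order.TTheory GRing.Theory Num.Theory.

Local Open Scope ring_scope.
Local Open Scope sesquilinear_scope.

(** * Conjugating a symmetric matrix by a rank-one unitary *)

Section Reflection.
Context (K : numClosedFieldType) (n : nat).

(** If [f] is real with [f *m f^T = 2] and [a = (u - 1) / 2], this map multiplies [f] by [u] and
    fixes its orthogonal complement. *)
Definition rank1_update (a : K) (f : 'rV[K]_n) : 'M[K]_n :=
  1%:M + a *: (f^T *m f).

Lemma rank1_update_mul (a b : K) (f : 'rV[K]_n) :
  f *m f^T = 2%:R%:M ->
  rank1_update a f *m rank1_update b f = rank1_update (a + b + 2%:R * (a * b)) f.
Proof.
move=> ff; rewrite /rank1_update mulmxDl !mulmxDr !mul1mx mulmx1.
rewrite -scalemxAl -scalemxAr mulmxA -[_ *m f^T]mulmxA ff mul_mx_scalar.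
rewrite -scalemxAl !scalerA -!addrA -!scalerDl; congr (_ + _ *: _); ring.
Qed.

Lemma rank1_update_adj (a : K) (f : 'rV[K]_n) :
  map_mx Num.conj f = f -> (rank1_update a f)^t* = rank1_update a^* f.
Proof.
move=> fr; have fj i : (f 0 i)^* = f 0 i by rewrite -{2}fr mxE.
apply/matrixP => i j; rewrite !mxE !big_ord1 !mxE rmorphD !rmorphM /= !fj.
by rewrite rmorph_nat eq_sym [f 0 j * _]mulrC.
Qed.

(** Scaling [f] by [v] and then by [u] scales it by [u * v], so the composite update has coefficient
    [(u * v - 1) / 2]. *)
Lemma half_diff_cancel (u v : K) :
  u * v = 1 ->
  (u - 1) / 2%:R + (v - 1) / 2%:R + 2%:R * ((u - 1) / 2%:R * ((v - 1) / 2%:R))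
  = 0.
Proof.
by move=> uv; transitivity ((u * v - 1) / 2%:R); [field | rewrite uv subrr mul0r].
Qed.

(** By symmetry [D *m f^T = l *: f^T + w^T]. After expansion [f^T *m f] carries the coefficient
    [l * (a + b + 2 * (a * b)) = 0], so only the cross terms with [w] survive. *)
Lemma reflect_symmetric (D : 'M[K]_n) (f w : 'rV[K]_n) (l u : K) :
  f *m D = l *: f + w -> D^T = D -> w *m f^T = 0 -> f *m f^T = 2%:R%:M ->
  u * u^* = 1 ->
  rank1_update ((u - 1) / 2%:R) f *m D *m rank1_update ((u^* - 1) / 2%:R) f
  = D + ((u - 1) / 2%:R) *: (f^T *m w) + ((u^* - 1) / 2%:R) *: (w^T *m f).
Proof.
move=> fD Dsym wf ff uu; set a := (u - 1) / _; set b := (_ - 1) / _.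
have Df : D *m f^T = l *: f^T + w^T.
  by rewrite -[D]Dsym -trmx_mul fD linearD /= linearZ.
have ab : a + b + 2%:R * (a * b) = 0 by apply: half_diff_cancel.
rewrite /rank1_update mulmxDl mul1mx -scalemxAl -(mulmxA f^T) fD.
rewrite mulmxDr mulmx1 -scalemxAr mulmxDl [D *m _]mulmxA Df -scalemxAl.
rewrite -(mulmxA f^T) [(_ + w) *m _]mulmxA (mulmxDl _ w) wf -scalemxAl ff.
rewrite addr0 scale_scalar_mx mul_scalar_mx -scalemxAr mulmxDl mulmxDr.
rewrite -scalemxAl -scalemxAr.
rewrite !scalerDr !scalerA.
set M := f^T *m f; set X := f^T *m w; set Y := w^T *m f.
have -> : b * a * (l * 2%:R) = - (a * l) - b * l.
  by apply/eqP; rewrite -subr_eq0; apply/eqP; rewrite -[RHS](mulr0 l) -ab; ring.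
apply/matrixP => i j; rewrite !mxE; ring.
Qed.

(** [H] is [D] conjugated by a unitary: since [f] is real and [a^* = b], the two updates are both
    adjoint and inverse to each other. *)
Lemma reflected_orthogonal (D : 'M[K]_n) (f w : 'rV[K]_n) (l u c : K) :
  f *m D = l *: f + w -> D^T = D -> w *m f^T = 0 -> f *m f^T = 2%:R%:M ->
  map_mx Num.conj f = f -> u * u^* = 1 -> D *m D^t* = c%:M ->
  let H := D + ((u - 1) / 2%:R) *: (f^T *m w)
             + ((u^* - 1) / 2%:R) *: (w^T *m f) in
  H *m H^t* = c%:M.
Proof.
move=> fD Dsym wf ff fr uu DD.
rewrite /= -(reflect_symmetric fD) //.
set a := (u - 1) / _; set b := (u^* - 1) / _.
have ca : a^* = b.
  rewrite /a /b rmorphM rmorphB rmorphV ?unitfE ?pnatr_eq0 //=.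
  by rewrite rmorph1 rmorph_nat.
have cb : b^* = a by rewrite -ca conjCK.
have ab : a + b + 2%:R * (a * b) = 0 by apply: half_diff_cancel.
rewrite !trmx_mul !map_mxM /= !rank1_update_adj // cb ca.
rewrite !mulmxA -[_ *m rank1_update b f *m _]mulmxA rank1_update_mul //.
rewrite [b + a]addrC [b * a]mulrC ab /(rank1_update 0) scale0r addr0 mulmx1.
rewrite -[_ *m D *m _]mulmxA DD mul_mx_scalar -scalemxAl rank1_update_mul //.
by rewrite ab /rank1_update scale0r addr0 scalemx1.
Qed.
End Reflection.

Local Open Scope complex_scope.

(** * Unimodular complex numbers, arguments and linear exponents *)

Section Phase.
Variable R : realType.

Lemma phaseD (a b : R) : phase (a + b) = phase a * phase b.
Proof.
by rewrite /phase cosD sinD; apply/eqP; rewrite eq_complex /=; apply/andP;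
   split; apply/eqP; ring.
Qed.

Lemma phase0 : phase (0 : R) = 1.
Proof. by rewrite /phase cos0 sin0. Qed.

Lemma norm_phase (a : R) : `|phase a| = 1.
Proof. by rewrite normc_def /= cos2Dsin2 sqrtr1. Qed.

Lemma phaseN (a : R) : phase (- a) = ((phase a)^*)%R.
Proof. by rewrite /phase cosN sinN. Qed.

(** Meant for unimodular [z]: [acos] only reaches the upper half circle, so the sign of the
    imaginary part selects the half. *)
Definition arg (z : R[i]) : R :=
  if 0 <= complex.Im z then acos (complex.Re z) else - acos (complex.Re z).

Lemma phase_arg (z : R[i]) : `|z| = 1 -> phase (arg z) = z.
Proof.
case: z => a b; rewrite normc_def /= => -[] /(congr1 (fun x => x ^+ 2)).
rewrite sqr_sqrtr ?addr_ge0 ?sqr_ge0 // expr1n => ab.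
have a1 : -1 <= a <= 1 by apply/andP; split; nra.
have b2 : 1 - a ^+ 2 = b ^+ 2 by rewrite -ab; ring.
rewrite /arg /=; case: (lerP 0 b) => b0.
  by rewrite /phase acosK // sin_acos // b2 sqrtr_sqr ger0_norm.
by rewrite /phase cosN sinN acosK // sin_acos // b2 sqrtr_sqr ltr0_norm ?opprK.
Qed.

Definition scaled_coord (c : R) (t : 'rV[R]_1) : R^o := c * t 0 0.

Fact scaled_coord_is_linear (c : R) : linear (scaled_coord c).
Proof. by move=> a s t; rewrite /scaled_coord !mxE /GRing.scale /=; ring. Qed.

HB.instance Definition _ (c : R) :=
  GRing.isLinear.Build R 'rV[R]_1 R^o *:%R (scaled_coord c)
    (scaled_coord_is_linear c).
End Phase.

Lemma conjM_eq1 (R : realType) (z : R[i]) : `|z| = 1 -> z * (z^*)%R = 1.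
Proof. by move=> z1; rewrite -normCK z1 expr1n. Qed.

Lemma complex_hadamard_scale (R : realType) (N : nat) (H : 'M[R[i]]_N)
    (d e : 'rV[R[i]]_N) :
  (forall i, `|d 0 i| = 1) -> (forall i, `|e 0 i| = 1) ->
  complex_hadamard H -> complex_hadamard (diag_mx d *m H *m diag_mx e).
Proof.
move=> d1 e1 [H1 HH]; split=> [i j|].
  by rewrite mul_mx_diag mxE mul_diag_mx mxE !normrM d1 H1 e1 !mulr1.
have unit (v : 'rV[R[i]]_N) : (forall i, `|v 0 i| = 1) ->
    diag_mx v *m (diag_mx v)^t* = 1%:M.
  move=> v1; apply/matrixP => i j; rewrite mul_diag_mx !mxE eq_sym.
  by case: eqVneq => [->|]; rewrite ?mulr1n ?conjM_eq1 // mulr0n rmorph0 mulr0.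
rewrite !trmx_mul !map_mxM !mulmxA -[_ *m diag_mx e *m _]mulmxA unit // mulmx1.
by rewrite -[_ *m H *m _]mulmxA HH mul_mx_scalar -scalemxAl unit // scalemx1.
Qed.

(** * The one-parameter orbit of a symmetric conference matrix *)

Section ConferenceOrbit.
Context (R : realType) (N : nat) (C : 'M[R]_N).
Hypotheses (confC : conference_matrix C) (symC : C^T = C).

Let D := conference_hadamard C.

Lemma conference_sym i j : C i j = C j i.
Proof. by rewrite -{1}symC mxE. Qed.

Lemma conference_hadamard_diag i : D i i = 1.
Proof. by case: confC => C0 _ _ _; rewrite !mxE C0 eqxx mulr0 addr0. Qed.

Lemma conference_hadamard_offdiag i j : i != j -> D i j = 'i * (C i j)%:C.
Proof. by move=> ij; rewrite !mxE (negPf ij) add0r. Qed.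

Lemma conference_hadamard_sym : D^T = D.
Proof.
by apply/matrixP => i j; rewrite !mxE conference_sym eq_sym.
Qed.

Lemma conference_sqr i j : i != j -> C i j * C i j = 1.
Proof.
by case: confC => _ C1 _ _ /C1[] ->; rewrite ?mulrNN mulr1.
Qed.

Lemma conference_hadamardP : complex_hadamard D.
Proof.
case: confC => C0 C1 CC _; split=> [i j|].
  have [->|ij] := eqVneq i j; first by rewrite conference_hadamard_diag normr1.
  rewrite conference_hadamard_offdiag // normc_def /=.
  rewrite !mul0r !mul1r subrr add0r expr0n /= add0r.
  by rewrite expr2 conference_sqr // sqrtr1.
(* As [C] is real symmetric, the product becomes [(1 + iC)(1 - iC) = 1 + C^2], and [C^2 = N - 1]. *)
have -> : D^t* = 1%:M - 'i *: map_mx (real_complex R) C.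
  rewrite conference_hadamard_sym; apply/matrixP => i j; rewrite !mxE.
  case: (i == j); apply/eqP; rewrite eq_complex /=;
  apply/andP; split; apply/eqP; ring.
have CC' : C *m C = (N%:R - 1)%:M by rewrite -{2}symC.
rewrite mulmxDl mul1mx mulmxBr mulmx1 -scalemxAl -scalemxAr scalerA.
rewrite -map_mxM CC' addrA subrK map_scalar_mx -expr2 sqr_i scaleN1r.
rewrite opprK; apply/matrixP => i j.
by rewrite !mxE -mulrnDl rmorphB rmorph_nat rmorph1 /= addrC subrK.
Qed.

Variables (o x y : 'I_N) (eps : R).
Hypotheses (xo : x != o) (yo : y != o) (xy : x != y).
Hypothesis epsE : eps = C x o * C y o.

Let S := [pred j | C x j * C y j == - eps].
Let P := pred2 x y.

Lemma eps_sqr : eps * eps = 1.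
Proof. by rewrite epsE mulrACA !conference_sqr // mulr1. Qed.

Lemma eps_sqrC : eps%:C * eps%:C = 1.
Proof. by rewrite -rmorphM eps_sqr rmorph1. Qed.

Lemma eps_neq0 : eps != 0.
Proof. by apply: contra_eq_neq eps_sqr => ->; rewrite mul0r eq_sym oner_eq0. Qed.

Lemma base_notin_pair : o \notin P.
Proof. by rewrite !inE negb_or ![o == _]eq_sym xo yo. Qed.

Lemma x_in_pair : x \in P.
Proof. by rewrite !inE eqxx. Qed.

Lemma conference_rows_split j : j \notin P -> (j \in S) || (C x j * C y j == eps).
Proof.
rewrite !inE negb_or => /andP[jx jy]; rewrite orbC -eqf_sqr !expr2 eps_sqr.
by rewrite mulrACA !conference_sqr // ?mulr1 // eq_sym.
Qed.

(** In columns [x] and [y] the zero diagonal of [C] makes the product 0, which is not [- eps]. *)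
Lemma rows_differ_notin j : j \in S -> j \notin P.
Proof.
case: confC => C0 _ _ _; apply: contraL.
by rewrite !inE => /orP[]/eqP->; rewrite C0 ?mulr0 ?mul0r eq_sym oppr_eq0 eps_neq0.
Qed.

Lemma rows_differ_base : o \notin S.
Proof. by rewrite inE -epsE -addr_eq0 -mulr2n mulrn_eq0 negb_or /= eps_neq0. Qed.

(** Otherwise the inner product of rows [x] and [y] would be [eps] times the number of columns
    outside [P], which is nonzero because [o] is such a column. *)
Lemma rows_differ_nonempty : exists j, j \in S.
Proof.
have [/existsP //|/existsPn noS] := boolP [exists j, j \in S]; exfalso.
case: confC => C0 _ /matrixP/(_ x y) + _; rewrite !mxE (negPf xy) mulr0n.
have -> : \sum_j C x j * C^T j y = \sum_(j | j \notin P) eps.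
  rewrite [RHS]big_mkcond; apply: eq_bigr => j _; rewrite mxE.
  have := @conference_rows_split j; rewrite (negPf (noS j)) /=.
  case: ifPn => [_ /(_ isT)/eqP//|/negPn + _].
  by rewrite !inE => /orP[]/eqP->; rewrite C0 ?mulr0 ?mul0r.
rewrite sumr_const => /eqP; rewrite mulrn_eq0 (negPf eps_neq0) orbF => /eqP.
move=> /card0_eq/(_ o); rewrite -topredE /=.
by rewrite base_notin_pair.
Qed.

Definition twist (u : R[i]) i j : R[i] :=
  if (i \in P) && (j \in S) then u
  else if (i \in S) && (j \in P) then (u^*)%R else 1.

Definition twisted (u : R[i]) : 'M[R[i]]_N := \matrix_(i, j) (D i j * twist u i j).

Definition pair_row : 'rV[R[i]]_N :=
  \row_j ((j == x)%:R - eps%:C * (j == y)%:R).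

(** This is the remainder [w]; the factor 2 arises on [S] from [D x j - eps * D y j] with
    [D y j = - eps * D x j]. *)
Definition differ_row : 'rV[R[i]]_N :=
  \row_j (if j \in S then 2%:R * D x j else 0).

Lemma pair_row_l : pair_row 0 x = 1.
Proof. by rewrite mxE eqxx (negPf xy) mulr0 subr0. Qed.

Lemma pair_row_r : pair_row 0 y = - eps%:C.
Proof. by rewrite mxE eqxx eq_sym (negPf xy) mulr1 sub0r. Qed.

Lemma pair_row_out j : j \notin P -> pair_row 0 j = 0.
Proof.
by rewrite !inE mxE => /norP[/negPf-> /negPf->]; rewrite mulr0 subr0.
Qed.

Lemma differ_row_in j : j \in S -> differ_row 0 j = 2%:R * D x j.
Proof. by rewrite [LHS]mxE => ->. Qed.

Lemma differ_row_out j : j \notin S -> differ_row 0 j = 0.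
Proof. by rewrite mxE => /negPf->. Qed.

Lemma pair_row_mul m (A : 'M_(N, m)) :
  pair_row *m A = row x A - eps%:C *: row y A.
Proof.
have -> : pair_row = delta_mx 0 x - eps%:C *: delta_mx 0 y.
  by apply/matrixP => i j; rewrite !mxE (ord1 i) eqxx.
by rewrite mulmxBl -scalemxAl -!rowE.
Qed.

Lemma differ_rows j : j \in S -> C y j = - (eps * C x j).
Proof.
move=> jS; have := rows_differ_notin jS; rewrite !inE => /norP[jx _].
rewrite -mulNr -(eqP jS) mulrAC conference_sqr ?mul1r // eq_sym //.
Qed.

Lemma agree_rows j : j \notin P -> j \notin S -> C y j = eps * C x j.
Proof.
move=> jP jS; have := conference_rows_split jP; rewrite (negPf jS) /= => /eqP<-.
move: jP; rewrite !inE => /norP[jx _].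
by rewrite mulrAC conference_sqr ?mul1r // eq_sym.
Qed.

Lemma conference_hadamard_differ j : j \in S -> D y j = - (eps%:C * D x j).
Proof.
move=> jS; have := rows_differ_notin jS; rewrite !inE => /norP[jx jy].
rewrite !conference_hadamard_offdiag 1?eq_sym // differ_rows // rmorphN rmorphM /=.
ring.
Qed.

Lemma row_differ i j :
  i \in P -> j \in S -> pair_row 0 i * differ_row 0 j = 2%:R * D i j.
Proof.
move=> iP jS; rewrite differ_row_in //.
move: iP; rewrite !inE => /orP[]/eqP->; first by rewrite pair_row_l mul1r.
by rewrite pair_row_r conference_hadamard_differ //; ring.
Qed.

(** Row [x] minus [eps] times row [y] of [D]: the two terms add up on [S] and cancel on the other
    columns outside [P]. The entries at [x] and [y] fix the scalar. *)
Lemma pair_row_eigen :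
  pair_row *m D = (1 - 'i * (eps * C x y)%:C) *: pair_row + differ_row.
Proof.
rewrite pair_row_mul; apply/rowP => j.
rewrite [LHS]mxE [row x D _ _]mxE [(- (_ *: _) : 'M__) _ _]mxE.
rewrite [(_ *: row y D) _ _]mxE [row y D _ _]mxE.
rewrite [RHS]mxE [(_ *: pair_row) _ _]mxE.
have [jS|jS] := boolP (j \in S).
  rewrite (pair_row_out (rows_differ_notin jS)) differ_row_in //.
  by rewrite conference_hadamard_differ // mulrN mulrA eps_sqrC; ring.
rewrite differ_row_out // addr0.
have [|jP] := boolP (j \in P); last first.
  move: (jP); rewrite !inE => /norP[jx jy].
  rewrite pair_row_out // mulr0 !conference_hadamard_offdiag 1?eq_sym //.
  rewrite agree_rows // rmorphM /=.
  rewrite [X in _ - X](_ : _ = eps%:C * eps%:C * ('i * (C x j)%:C)); last by ring.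
  by rewrite eps_sqrC mul1r subrr.
rewrite !inE => /orP[]/eqP->.
  rewrite pair_row_l conference_hadamard_diag conference_hadamard_offdiag 1?eq_sym //.
  by rewrite [C y x]conference_sym rmorphM /=; ring.
rewrite pair_row_r conference_hadamard_diag conference_hadamard_offdiag // rmorphM /=.
apply/eqP; rewrite -subr_eq0; apply/eqP.
transitivity ('i * (C x y)%:C * (1 - eps%:C * eps%:C)); first by ring.
by rewrite eps_sqrC subrr mulr0.
Qed.

Lemma differ_pair_ortho : differ_row *m pair_row^T = 0.
Proof.
apply/matrixP => i j; rewrite !ord1 [LHS]mxE big1 ?mxE // => k _.
rewrite [pair_row^T _ _]mxE; have [kS|kS] := boolP (k \in S).
  by rewrite pair_row_out ?mulr0 // rows_differ_notin.
by rewrite differ_row_out // mul0r.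
Qed.

Lemma pair_row_norm : pair_row *m pair_row^T = 2%:R%:M.
Proof.
rewrite pair_row_mul; apply/matrixP => i j; rewrite !ord1.
rewrite [LHS]mxE [row x _ _ _]mxE [(- (_ *: _) : 'M__) _ _]mxE.
rewrite [(_ *: row y _) _ _]mxE [row y _ _ _]mxE.
rewrite ![pair_row^T _ _]mxE pair_row_l pair_row_r mulrN opprK eps_sqrC.
by rewrite mxE eqxx mulr1n.
Qed.

Lemma pair_row_real : map_mx Num.conj pair_row = pair_row.
Proof.
apply/matrixP => i j; rewrite !mxE rmorphB rmorphM !rmorph_nat /=.
by rewrite /Num.conj /= oppr0.
Qed.

(** The outer products live on the disjoint blocks [P] by [S] and [S] by [P], where they equal
    [2 * D i j]; adding [(v - 1) / 2] times this multiplies the entry by [v]. *)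
Lemma twistedE u :
  twisted u = D + ((u - 1) / 2%:R) *: (pair_row^T *m differ_row)
               + (((u^*)%R - 1) / 2%:R) *: (differ_row^T *m pair_row).
Proof.
apply/matrixP => i j; rewrite [LHS]mxE [RHS]mxE [(D + _) _ _]mxE -addrA.
rewrite [X in _ = _ + (X + _)]mxE [X in _ = _ + (_ + X)]mxE.
rewrite [(pair_row^T *m _) _ _]mxE [(differ_row^T *m _) _ _]mxE !big_ord1.
rewrite [pair_row^T _ _]mxE [differ_row^T _ _]mxE /twist.
have half (v : R[i]) : D i j + (v - 1) / 2%:R * (2%:R * D i j) = D i j * v.
  by field.
have off k l : (k \in P) && (l \in S) = false -> pair_row 0 k * differ_row 0 l = 0.
  case: (boolP (k \in P)) => [_ /= /negbT lS|kP _].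
    by rewrite differ_row_out ?mulr0.
  by rewrite pair_row_out ?mul0r.
case: ifP => [/andP[iP jS]|/off->].
  rewrite row_differ // differ_row_out ?mul0r ?mulr0 ?addr0 ?half //.
  by apply: contraL iP; apply: rows_differ_notin.
rewrite mulr0 add0r [differ_row _ _ * _]mulrC andbC.
case: ifP => [/andP[jP iS]|/off->]; last by rewrite mulr0 addr0 mulr1.
rewrite row_differ // (_ : D j i = D i j) ?half //.
by rewrite -{1}conference_hadamard_sym [LHS]mxE.
Qed.

Lemma norm_twist u i j : `|u| = 1 -> `|twist u i j| = 1.
Proof. by move=> u1; rewrite /twist; do ?case: ifP => _; rewrite ?norm_conjC ?normr1. Qed.

Lemma twisted_hadamard u : `|u| = 1 -> complex_hadamard (twisted u).
Proof.
case: conference_hadamardP => D1 DD u1; split=> [i j|].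
  by rewrite mxE normrM D1 norm_twist // mulr1.
rewrite twistedE; apply: (reflected_orthogonal pair_row_eigen) => //.
- exact: conference_hadamard_sym.
- exact: differ_pair_ortho.
- exact: pair_row_norm.
- exact: pair_row_real.
- exact: conjM_eq1.
Qed.

Lemma twist_base u i j : i = o \/ j = o -> twist u i j = 1.
Proof.
have oP := negPf base_notin_pair; have oS := negPf rows_differ_base.
by rewrite /twist => -[]->; rewrite oP oS ?andbF.
Qed.

(** The weight 1, -1 or 0 with which the parameter enters the phase, -1 marking the conjugated
    block. *)
Definition exponent i j : R :=
  ((i \in P) && (j \in S))%:R - ((i \in S) && (j \in P))%:R.

Lemma twist_phase (a : R) i j : twist (phase a) i j = phase (exponent i j * a).
Proof.
rewrite /twist /exponent; case: ifP => [/andP[iP _]|_].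
  have iS : i \notin S by apply: contraL iP; apply: rows_differ_notin.
  by rewrite (negPf iS) subr0 mul1r.
case: ifP => _; first by rewrite sub0r mulN1r phaseN.
by rewrite subrr mul0r phase0.
Qed.

(** Conjugating column and row [o] of [D] dephases every member at once, since [twist] is 1 there
    and [D o o = 1]. *)
Let dl : 'rV[R[i]]_N := \row_i ((D i o)^*)%R.
Let dr : 'rV[R[i]]_N := \row_j ((D o j)^*)%R.

Definition dephased_orbit (t : 'rV[R]_1) : 'M[R[i]]_N :=
  diag_mx dl *m twisted (phase (t 0 0)) *m diag_mx dr.

Lemma dephased_orbitE t i j :
  dephased_orbit t i j =
  ((D i o)^*)%R * D i j * ((D o j)^*)%R * phase (exponent i j * t 0 0).
Proof.
rewrite /dephased_orbit mul_mx_diag mxE mul_diag_mx mxE.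
rewrite [dl _ _]mxE [dr _ _]mxE [twisted _ _ _]mxE -twist_phase.
ring.
Qed.

Lemma norm_conj_entry i j : `|((D i j)^*)%R| = 1.
Proof. by case: conference_hadamardP => D1 _; rewrite norm_conjC. Qed.

Lemma dephased_orbit_hadamard t : complex_hadamard (dephased_orbit t).
Proof.
apply: complex_hadamard_scale => [i|j|].
- by rewrite mxE norm_conj_entry.
- by rewrite mxE norm_conj_entry.
- by apply: twisted_hadamard; apply: norm_phase.
Qed.

Lemma dephased_orbit_affine : affine_family dephased_orbit.
Proof.
exists (\matrix_(i, j) arg (((D i o)^*)%R * D i j * ((D o j)^*)%R)).
exists (fun i j => scaled_coord (exponent i j)) => t i j.
rewrite dephased_orbitE mxE phaseD phase_arg //.
by case: conference_hadamardP => D1 _; rewrite !normrM !norm_conj_entry D1 !mulr1.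
Qed.

Lemma dephased_orbit_base t i j : i = o \/ j = o -> dephased_orbit t i j = 1.
Proof.
have [D1 _] := conference_hadamardP => ij.
rewrite dephased_orbitE -twist_phase twist_base // mulr1.
case: ij => ->; rewrite conference_hadamard_diag rmorph1 ?mul1r ?mulr1.
  exact: conjM_eq1.
by rewrite mulrC conjM_eq1.
Qed.

Lemma dephased_orbit0 : dephased_orbit 0 = diag_mx dl *m D *m diag_mx dr.
Proof.
congr (_ *m _ *m _); apply/matrixP => i j.
by rewrite [LHS]mxE twist_phase [X in exponent _ _ * X]mxE mulr0 phase0 mulr1.
Qed.

Lemma dephased_orbit_nonconstant : exists s t, dephased_orbit s <> dephased_orbit t.
Proof.
have [j jS] := rows_differ_nonempty; have [D1 _] := conference_hadamardP.
(* With [j] in [S], the entry at [(x, j)] carries the factor 1 at parameter 0 and -1 at [pi]. *)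
exists 0, (const_mx pi) => /matrixP/(_ x j); rewrite !dephased_orbitE.
rewrite [(0 : 'rV_1) _ _]mxE [const_mx _ _ _]mxE.
set c := (_^*)%R * _ * (_^*)%R; have c0 : c != 0.
  by rewrite -normr_gt0 !normrM !norm_conj_entry D1 !mulr1 ltr01.
have -> : exponent x j = 1.
  rewrite /exponent jS x_in_pair (negPf (_ : x \notin S)) ?subr0 //.
  by apply: contraL x_in_pair; apply: rows_differ_notin.
rewrite mulr0 mul1r phase0 => /(mulfI c0); rewrite /phase cospi sinpi => -[].
by move=> h; lra.
Qed.

Lemma conference_affine_orbit : o = 0%N :> nat -> admits_affine_orbit D.
Proof.
move=> o0; have [D1 _] := conference_hadamardP.
have base t : dephased (dephased_orbit t).
  by move=> i j ij; apply: dephased_orbit_base; case: ij => E; [left|right];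
     apply/val_inj; rewrite /= E o0.
exists 1%N, dephased_orbit; split.
- by split=> //; apply: dephased_orbit_affine.
- exact: dephased_orbit_hadamard.
- exact: base.
- exact: dephased_orbit_nonconstant.
- exists 0; split; first exact: base.
  exists dl, dr; split=> [i|j|]; rewrite ?dephased_orbit0 // mxE.
  + exact: norm_conj_entry.
  + exact: norm_conj_entry.
Qed.
End ConferenceOrbit.

(* In orders 1 and 2 the only dephased complex Hadamard matrix is the real
   one, so there is no orbit there: the trivial orders must be excluded. *)
Theorem theorem4p3 (R : realType) (N : nat) (C : 'M[R]_N) :
  (2 < N)%N -> conference_matrix C -> C^T%R = C ->
  admits_affine_orbit (conference_hadamard C).
Proof.
move=> N2 confC symC.
(* The indices 0, 1, 2 serve as [o], [x], [y]; base 0 matches [dephased], and [erefl] determines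
   [eps]. *)
by apply: (@conference_affine_orbit _ _ C confC symC
  (Ordinal (ltnW (ltnW N2))) (Ordinal (ltnW N2)) (Ordinal N2) _ _ _ _ erefl).
Qed.
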